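(* Let $q=p^m$ be a prime power and let $\mathbb{F}_q$ be the finite field with $q$ elements. Let $A,B\subset\mathbb{F}_q$ be arbitrary subsets with $|A||B|\geqslant 2q$. Then $8AB=\mathbb{F}_q$.
   Context: For $X,Y\subset\mathbb{F}_q$, $XY=\{xy: x\in X, y\in Y\}$, and for a natural number $k$, $kX=\{x_1+\dots+x_k: x_1,\dots,x_k\in X\}$; thus $8AB$ is the set of all sums of $8$ elements of $AB$. *)

(* Defs.v *)
From HB Require Import structures.
From mathcomp Require Import all_boot all_order all_algebra.

Set Implicit Arguments.
Unset Strict Implicit.
Unset Printing Implicit Defensive.

Import GRing.Theory.
Local Open Scope ring_scope.

Definition prodset (F : finFieldType) (X Y : {set F}) : {set F} :=
  [set x * y | x in X, y in Y].

(* The k-fold sumset kX (not the dilate); the summands may repeat. *)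
Definition sumset (F : finFieldType) (k : nat) (X : {set F}) : {set F} :=
  [set \sum_(i < k) x i | x : {ffun 'I_k -> F} & [forall i, x i \in X]].

(* Main.v *)
(* Averaging the additive energy of A and cB over c != 0 gives, as soon as
   |A||B| >= q, some c with |A + cB| > q/2; since E(A, cB) = E(A, -cB), also
   |A - cB| > q/2 for the same c.  If v != 0 and v(A + cB) is contained in 4AB,
   then doubling a set of more than q/2 elements gives 8AB = F.
   To find v, split B into T = B n -B and B' = B \ T.
   - If |A||B'| >= q, then A - cB' meets its negative, so
     a1 + a2 = c(b1 + b2), and v = b1 + b2 is nonzero as B' n -B' is empty.
   - Otherwise |A||T| > q, so (a, t) |-> a + ct is not injective on A x T:
     a1 - a2 = c(t2 - t1) with v = t2 - t1 nonzero, and T = -T absorbs the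
     minus signs. *)

Require Import Defs.
From mathcomp Require Import all_boot all_order all_algebra.
From mathcomp Require Import ring zify.

Set Implicit Arguments.
Unset Strict Implicit.
Unset Printing Implicit Defensive.

Import GRing.Theory.

Local Open Scope ring_scope.

(** Cauchy-Schwarz for the fibre sizes [r z]: they sum to [#|X|], and their squares sum to the
    number of colliding pairs. *)
Lemma sqr_card_imset_leq (T U : finType) (f : T -> U) (X : {set T}) :
  (#|X| ^ 2 <= #|f @: X| * \sum_(x in X) \sum_(y in X) (f x == f y))%N.
Proof.
pose r z := (\sum_(x in X) (f x == z))%N.
have rE : (\sum_(z in f @: X) r z = #|X|)%N.
  rewrite exchange_big -sum1_card; apply: eq_bigr => x xX.
  rewrite (bigD1 (f x)) ?imset_f //= eqxx big1 // => z /andP[_ /negbTE].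
  by rewrite eq_sym => ->.
have rr : (\sum_(z in f @: X) r z ^ 2 = \sum_(x in X) \sum_(y in X) (f x == f y))%N.
  under eq_bigr => z _ do rewrite -mulnn big_distrl /=.
  rewrite exchange_big; apply: eq_bigr => x xX /=.
  rewrite (bigD1 (f x)) ?imset_f //= eqxx mul1n big1 ?addn0 => [|z /andP[_ /negbTE]].
    by apply: eq_bigr => y _; rewrite eq_sym.
  by rewrite eq_sym => ->.
(* After doubling both sides, it suffices to sum [2 * (r z * r t) <= r z ^ 2 + r t ^ 2] over all
   pairs [z], [t]. *)
rewrite -rr -(leq_pmul2l (isT : 0 < 2)%N) -{1}rE -mulnn big_distrlr /= big_distrr /=.
have -> : (2 * (#|f @: X| * \sum_(z in f @: X) r z ^ 2) =
           \sum_(z in f @: X) \sum_(t in f @: X) (r z ^ 2 + r t ^ 2))%N.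
  under [RHS]eq_bigr => z _ do rewrite big_split /= sum_nat_const.
  by rewrite big_split /= -big_distrr /= sum_nat_const mul2n addnn.
apply: leq_sum => z _; rewrite big_distrr /=; apply: leq_sum => t _.
exact: nat_Cauchy.
Qed.

Lemma big_setX_nat (T U : finType) (A : {set T}) (B : {set U}) (G : T * U -> nat) :
  (\sum_(x in setX A B) G x = \sum_(a in A) \sum_(b in B) G (a, b))%N.
Proof.
rewrite pair_big /=; apply: eq_big => [[a b]|[a b] _] //=.
by rewrite in_setX.
Qed.

Section Expansion.

Variable F : finFieldType.
Implicit Types (A B D X : {set F}) (c v z : F).

Definition dilate_sum A B c : {set F} := [set x.1 + c * x.2 | x in setX A B].

Definition energy A B c : nat :=
  (\sum_(a in A) \sum_(a' in A) \sum_(b in B) \sum_(b' in B)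
     (a + c * b == a' + c * b')%R)%N.

(* Exchange b and b'. *)
Lemma energyN A B c : energy A B (- c) = energy A B c.
Proof.
apply: eq_bigr => a _; apply: eq_bigr => a' _; rewrite exchange_big.
apply: eq_bigr => b _; apply: eq_bigr => b' _; congr nat_of_bool.
by apply/eqP/eqP => h; apply/eqP; rewrite -subr_eq0; move/eqP: h;
  rewrite -subr_eq0 => /eqP h; apply/eqP; rewrite -[RHS]h; ring.
Qed.

Lemma energy_Cauchy A B c :
  ((#|A| * #|B|) ^ 2 <= #|dilate_sum A B c| * energy A B c)%N.
Proof.
have := sqr_card_imset_leq (fun x : F * F => x.1 + c * x.2) (setX A B).
rewrite cardsX -/(dilate_sum A B c); congr (_ <= _ * _)%N.
rewrite big_setX_nat; apply: eq_bigr => a _.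
by rewrite exchange_big /= big_setX_nat; apply: eq_bigr => a' _; rewrite exchange_big.
Qed.

Lemma sum_diag_offdiag A (x y : nat) :
  (\sum_(a in A) \sum_(a' in A) ((a == a') * x + (a != a') * y) =
   #|A| * (x + #|A|.-1 * y))%N.
Proof.
rewrite -sum_nat_const; apply: eq_bigr => a aA.
rewrite (bigD1 a) //= eqxx mul1n mul0n addn0; congr (_ + _)%N.
rewrite (eq_bigr (fun=> y)) => [|a' /andP[_]]; last first.
  by rewrite eq_sym => /negbTE ->; rewrite mul0n mul1n.
rewrite (eq_bigl (mem (A :\ a))) ?sum_nat_const => [|a']; last by rewrite !inE andbC.
by rewrite (cardsD1 a A) aA.
Qed.

(** If [b = b'], every [c] or none is a solution. Otherwise the only root is [(a' - a) / (b - b')],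
    which is the excluded value 0 when [a = a']. The bound is split along the diagonals to suit
    [sum_diag_offdiag]. *)
Lemma card_slopes (a a' b b' : F) :
  (\sum_(c | c != 0%R) (a + c * b == a' + c * b')%R <=
   (a == a') * ((b == b') * #|F|.-1 + (b != b') * 0)
   + (a != a') * ((b == b') * 0 + (b != b') * 1))%N.
Proof.
have [->|bb'] := eqVneq b b'; rewrite /= ?mul0n ?mul1n ?muln0 ?addn0 ?muln1 ?add0n.
  under eq_bigr => c _ do rewrite (can_eq (addrK _)).
  by rewrite sum_nat_const mulnC leq_mul // cardC1.
have eqc c : (a + c * b == a' + c * b') = (c == (a' - a) / (b - b')).
  have nz : b - b' != 0 by rewrite subr_eq0.
  rewrite -[RHS](inj_eq (mulIf nz)) divfK //; apply/eqP/eqP => h.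
    by apply/eqP; rewrite -subr_eq0; apply/eqP;
      transitivity ((a + c * b) - (a' + c * b')); [ring | rewrite h subrr].
  by apply/eqP; rewrite -subr_eq0; apply/eqP;
    transitivity (c * (b - b') - (a' - a)); [ring | rewrite h subrr].
under eq_bigr => c _ do rewrite eqc.
have [<-|_] := eqVneq a a'.
  by rewrite subrr mul0r big1 // => c /negbTE ->.
rewrite big_mkcond (bigD1 ((a' - a) / (b - b'))) //= eqxx big1 => [|c /negbTE ->].
  by case: ifP.
by case: ifP.
Qed.

Lemma sum_energy_leq A B :
  (\sum_(c | c != 0%R) energy A B c <=
   #|A| * #|B| * (#|F|.-1 + #|A|.-1 * #|B|.-1))%N.
Proof.
rewrite exchange_big.
apply: (@leq_trans (\sum_(a in A) \sum_(a' in A)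
   ((a == a') * (#|B| * #|F|.-1) + (a != a') * (#|B| * #|B|.-1)))); last first.
  by rewrite sum_diag_offdiag; lia.
apply: leq_sum => a _; rewrite exchange_big; apply: leq_sum => a' _.
have := sum_diag_offdiag B #|F|.-1 0; have := sum_diag_offdiag B 0 1.
rewrite muln0 addn0 muln1 add0n => <- <-.
rewrite 2!big_distrr -big_split /= exchange_big; apply: leq_sum => b _.
rewrite 2!big_distrr -big_split /= exchange_big; apply: leq_sum => b' _.
exact: card_slopes.
Qed.

(** Otherwise all [#|F|.-1] nonzero slopes have large energy, and their total exceeds the bound of
    [sum_energy_leq]. *)
Lemma exists_small_energy A B : (#|F| <= #|A| * #|B|)%N ->
  exists2 c, c != 0 & (#|F| * energy A B c < 2 * (#|A| * #|B|) ^ 2)%N.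
Proof.
move=> leAB.
have [/existsP[c /andP[c0 Ec]]|] :=
  boolP [exists c : F, (c != 0) && (#|F| * energy A B c < 2 * (#|A| * #|B|) ^ 2)%N].
  by exists c.
rewrite negb_exists => /forallP H; exfalso.
have : (#|F|.-1 * (2 * (#|A| * #|B|) ^ 2) <=
        #|F| * (#|A| * #|B| * (#|F|.-1 + #|A|.-1 * #|B|.-1)))%N.
  apply: leq_trans (leq_mul (leqnn _) (sum_energy_leq A B)).
  rewrite big_distrr /= -(cardC1 (0 : F)) -sum_nat_const.
  apply: leq_sum => c c0; have := H c.
  by rewrite negb_and -leqNgt => /orP[/negP[]|].
have := card_finNzRing_gt1 F.
have := max_card (mem A); have := max_card (mem B).
move: leAB; move: #|F| #|A| #|B| => q a b.
case: q => [|q] //; case: a => [|a]; first by lia.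
case: b => [|b]; first by lia.
move=> /= leAB hb ha q1.
rewrite -mulnn => h.
have {}h : (q * (2 * (a.+1 * b.+1)) <= q.+1 * (q + a * b))%N.
  by rewrite -(@leq_pmul2l (a.+1 * b.+1)) //; lia.
(* Here [q], [a], [b] are the cardinalities minus one. Combined with [h] this leaves
   [q * (a + b + 1) <= a * b], impossible since [a * b <= a * q] and [q > 0]. *)
have : (q * q.+1 <= q * (a.+1 * b.+1))%N by rewrite leq_mul.
have : (a * b <= a * q)%N by rewrite leq_mul.
nia.
Qed.

Lemma exists_large_dilate_sums A B : (#|F| <= #|A| * #|B|)%N ->
  exists c, (#|F| < 2 * #|dilate_sum A B c|)%N /\
            (#|F| < 2 * #|dilate_sum A B (- c)|)%N.
Proof.
move=> leAB; have [c _ Ec] := exists_small_energy leAB.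
have large d : energy A B d = energy A B c -> (#|F| < 2 * #|dilate_sum A B d|)%N.
  move=> Ed; have := energy_Cauchy A B d; rewrite Ed.
  move=> CS; move: Ec; rewrite !ltnNge; apply: contra => leD.
  apply: leq_trans (leq_mul (leqnn 2) CS) _.
  by rewrite mulnA leq_mul.
by exists c; split; apply: large; rewrite ?energyN.
Qed.

(** Pigeonhole: [D] and [z - X] have together more than [#|F|] elements, so they meet. *)
Lemma large_sets_add D X z :
  (#|F| < 2 * #|D|)%N -> (#|F| < 2 * #|X|)%N ->
  exists x y, [/\ x \in D, y \in X & z = x + y].
Proof.
move=> hD hX; pose Y := [set z - y | y in X].
have cY : #|Y| = #|X| by apply: card_imset => s t /addrI /oppr_inj.
have /card_gt0P[x] : (0 < #|D :&: Y|)%N.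
  have leU : (#|D :|: Y| <= #|F|)%N by exact: max_card.
  by have := cardsUI D Y; rewrite cY; lia.
rewrite inE => /andP[xD /imsetP[y yX xE]].
by exists x, y; split => //; rewrite xE subrK.
Qed.

Lemma mem_sumset X (s : seq F) :
  {subset s <= X} -> \sum_(x <- s) x \in sumset (size s) X.
Proof.
move=> sX; apply/imsetP; exists [ffun i : 'I_(size s) => s`_i].
  by rewrite inE; apply/forallP => i; rewrite ffunE sX ?mem_nth.
by rewrite (big_nth 0) big_mkord; apply: eq_bigr => i _; rewrite ffunE.
Qed.

Lemma sumset_full_of_dilate X D v : v != 0 -> (#|F| < 2 * #|D|)%N ->
  (forall x, x \in D -> exists s : seq F,
     [/\ size s = 4%N, {subset s <= X} & v * x = \sum_(y <- s) y]) ->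
  sumset 8 X = [set: F].
Proof.
move=> v0 hD H; apply/setP => z; rewrite inE.
have [x [y [xD yD zE]]] := large_sets_add (z / v) hD hD.
have [s [s4 sX sE]] := H _ xD; have [t [t4 tX tE]] := H _ yD.
have -> : z = \sum_(w <- s ++ t) w.
  by rewrite big_cat /= -sE -tE -mulrDr -zE mulrC divfK.
have <- : size (s ++ t) = 8%N by rewrite size_cat s4 t4.
apply: mem_sumset => w.
by rewrite mem_cat => /orP[/sX|/tX].
Qed.

Lemma mem_prodset A B a b : a \in A -> b \in B -> a * b \in prodset A B.
Proof. by move=> aA bB; apply: imset2_f. Qed.

Lemma sumset_prodset_antisym A B : (#|F| <= #|A| * #|B|)%N ->
  {in B &, forall b b', b + b' != 0} ->
  sumset 8 (prodset A B) = [set: F].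
Proof.
move=> leAB asymB; have [c [hp hm]] := exists_large_dilate_sums leAB.
have [x [y [/imsetP[[a1 b1] h1 ->] /imsetP[[a2 b2] h2 ->] /= eq0]]] :=
  large_sets_add 0 hm hm.
move: h1 h2; rewrite !in_setX /= => /andP[a1A b1B] /andP[a2A b2B].
apply: (sumset_full_of_dilate (asymB _ _ b1B b2B) hp) => _ /imsetP[[a b] + ->] /=.
rewrite in_setX /= => /andP[aA bB].
(* By [eq0], [c * (b1 + b2) = a1 + a2], so multiplying [a + c * b] by [b1 + b2] gives these four
   products. *)
exists [:: a * b1; a * b2; a1 * b; a2 * b]; split => //.
  by move=> w; rewrite !inE => /or4P[] /eqP ->; apply: mem_prodset.
rewrite !big_cons big_nil; apply/eqP; rewrite -subr_eq0; apply/eqP.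
transitivity ((a1 + - c * b1 + (a2 + - c * b2)) * - b); first by ring.
by rewrite -eq0 mul0r.
Qed.

Lemma sumset_prodset_sym A B : (#|F| < #|A| * #|B|)%N ->
  {in B, forall b, - b \in B} ->
  sumset 8 (prodset A B) = [set: F].
Proof.
move=> ltAB symB; have [c [hp _]] := exists_large_dilate_sums (ltnW ltAB).
have /dinjectivePn[[a1 b1] h1 [[a2 b2] /andP[ne h2] /= eq12]] :
    ~~ dinjectiveb (fun x : F * F => x.1 + c * x.2) (mem (setX A B)).
  apply: contraL ltAB => /dinjectiveP inj.
  by rewrite -leqNgt -cardsX -(card_in_imset inj) max_card.
move: h1 h2; rewrite !in_setX /= => /andP[a1A b1B] /andP[a2A b2B].
(* If [b1 = b2], then [eq12] gives [a1 = a2], but the colliding pairs are distinct. *)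
have nz : b2 - b1 != 0.
  apply: contra ne; rewrite subr_eq0 => /eqP b12.
  by rewrite b12 in eq12 *; move/addIr: eq12 => ->.
apply: (sumset_full_of_dilate nz hp) => _ /imsetP[[a b] + ->] /=.
rewrite in_setX /= => /andP[aA bB].
(* By [eq12], [c * (b2 - b1) = a1 - a2]; the symmetry of [B] keeps [- b1] and [- b] in [B]. *)
exists [:: a * b2; a * - b1; a1 * b; a2 * - b]; split => //.
  by move=> w; rewrite !inE => /or4P[] /eqP ->; apply: mem_prodset; rewrite ?symB.
rewrite !big_cons big_nil; apply/eqP; rewrite -subr_eq0; apply/eqP.
transitivity (((a2 + c * b2) - (a1 + c * b1)) * b); first by ring.
by rewrite eq12 subrr mul0r.
Qed.

Lemma sumsetS k X D : X \subset D -> sumset k X \subset sumset k D.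
Proof.
move=> /subsetP XD; apply/subsetP => _ /imsetP[x + ->].
rewrite inE => /forallP xX; apply: imset_f.
by rewrite inE; apply/forallP => i; apply: XD.
Qed.

Lemma prodsetSr A B D : B \subset D -> prodset A B \subset prodset A D.
Proof. by move=> BD; apply: imset2S. Qed.

End Expansion.

Theorem theorem10 (p m q : nat) (hp : prime p) (hm : (0 < m)%N)
    (hq : q = (p ^ m)%N) (F : finFieldType) (hF : #|F| = q)
    (A B : {set F}) (hAB : (2 * q <= #|A| * #|B|)%N) :
  sumset 8 (prodset A B) = [set: F].
Proof.
pose T := [set b in B | - b \in B].
have full (D : {set F}) : D \subset B -> sumset 8 (prodset A D) = [set: F] ->
    sumset 8 (prodset A B) = [set: F].
  move=> DB fD; apply/eqP; rewrite -subTset -fD.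
  exact/sumsetS/prodsetSr.
have TB : T \subset B by apply/subsetP => b; rewrite inE => /andP[].
have [leD|ltD] := leqP #|F| (#|A| * #|B :\: T|).
  apply: (full (B :\: T)); first exact: subsetDl.
  apply: sumset_prodset_antisym => // b b'.
  (* If [b + b' = 0], then [- b = b'] lies in [B], which puts [b] in [T]. *)
  rewrite !inE => /andP[+ bB] /andP[_ b'B]; rewrite bB /= addrC addr_eq0.
  by apply: contra => /eqP <-.
apply: (full T) => //; apply: sumset_prodset_sym => [|b].
  (* The factor 2 in [hAB] is spent here: [#|A| * #|T|] and [#|A| * #|B :\: T|] add up to at least
     [2 * q], and the second is below [q]. *)
  have := cardsID T B; rewrite (setIidPr TB) => cB.
  by move: hAB ltD; rewrite -hF -cB mulnDr; lia.
by rewrite !inE opprK => /andP[-> ->].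
Qed.
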